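(* Let $p$ be a prime. For integers $a\ge b\ge 0$ define \[ K(a,b) = \frac{\prod_{i=1}^a (1-1/p^i)}{p^{\binom{b+1}{2}} \prod_{i=1}^b (1-1/p^i) \prod_{j=1}^{\lfloor (a-b)/2 \rfloor} (1-1/p^{2j}) }, \] and for $a=\infty$ and integer $b\ge0$ define \[ K(\infty,b)=\frac{\prod_{i=1}^\infty (1-1/p^i)}{p^{\binom{b+1}{2}} \prod_{i=1}^b (1-1/p^i) \prod_{j=1}^{\infty} (1-1/p^{2j}) }. \] Starting with $\lambda_0'=\infty$, define random nonnegative integers $\lambda_1',\lambda_2',\dots$ in succession by the rule that if $\lambda_i'=a$, then $\lambda_{i+1}'=b$ (with $b\le a$) with probability $K(a,b)$. Then (almost surely) $\lambda_1'\ge\lambda_2'\ge\cdots$ are the column lengths of a partition $\lambda$ (i.e. $\lambda'=(\lambda_1',\lambda_2',\dots)$ is its transpose), and $\lambda$ is distributed according to the probability measure \[ \pi(\lambda)=\frac{\prod_{i \text{ odd},\, i\ge1} (1-1/p^i)}{p^{\sum_i \mu_i(\mu_i+1)/2} \prod_{i=1}^{\lambda_1} \prod_{j=1}^{\lfloor (\mu_i - \mu_{i+1})/2 \rfloor}(1-1/p^{2j})},\qquad \mu=\lambda'. \]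
   Context: For a partition $\lambda$, $\lambda'$ (also written $\mu$) is its transpose: $\mu_i$ is the number of parts of $\lambda$ of size at least $i$; $\lambda_1$ is the largest part and $\mu_{\lambda_1+1}=0$. Empty products equal $1$. *)

(* Defs.v *)
From HB Require Import structures.
From mathcomp Require Import all_boot all_order all_algebra.
From mathcomp Require Import all_classical all_reals all_analysis.

Set Implicit Arguments.
Unset Strict Implicit.
Unset Printing Implicit Defensive.

Import Order.TTheory GRing.Theory Num.Theory.
Import numFieldNormedType.Exports.

Local Open Scope classical_set_scope.
Local Open Scope ring_scope.

Definition is_part (s : seq nat) : bool := sorted geq s && (0%N \notin s).

Record intpart := IntPart { parts :> seq nat; partsP : is_part parts }.

HB.instance Definition _ := [isSub for parts].
HB.instance Definition _ := [Countable of intpart by <:].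

Definition largest_part (lam : intpart) : nat := head 0%N lam.

(* The i-th part of the transpose of lam, indexed from i = 1. *)
Definition part_col (lam : intpart) (i : nat) : nat :=
  count (fun x => (i <= x)%N) lam.

Definition infprod (R : realType) (f : nat -> R) : R :=
  lim ((fun n => \prod_(1 <= i < n.+1) f i) @ \oo).

Definition infprod_odd (R : realType) (f : nat -> R) : R :=
  lim ((fun n => \prod_(1 <= i < n.+1 | odd i) f i) @ \oo).

(* [None] stands for a = oo.  The value is only meaningful for b <= a. *)
Definition K (R : realType) (p : nat) (a : option nat) (b : nat) : R :=
  match a with
  | Some a =>
      (\prod_(1 <= i < a.+1) (1 - 1 / p%:R ^+ i)) /
      (p%:R ^+ 'C(b.+1, 2) * (\prod_(1 <= i < b.+1) (1 - 1 / p%:R ^+ i)) *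
       \prod_(1 <= j < ((a - b) %/ 2).+1) (1 - 1 / p%:R ^+ (2 * j)))
  | None =>
      infprod (fun i => 1 - 1 / p%:R ^+ i) /
      (p%:R ^+ 'C(b.+1, 2) * (\prod_(1 <= i < b.+1) (1 - 1 / p%:R ^+ i)) *
       infprod (fun j => 1 - 1 / p%:R ^+ (2 * j)))
  end.

Definition le_state (b : nat) (a : option nat) : bool :=
  if a is Some a then (b <= a)%N else true.

Definition trans (R : realType) (p : nat) (a : option nat) (b : nat) : R :=
  if le_state b a then K R p a b else 0.

(* [X j] is the random integer lambda'_(j+1), so that [state X i w] is
   lambda'_i, with lambda'_0 = oo. *)
Definition state (T : Type) (X : nat -> T -> nat) (i : nat) (w : T)
    : option nat :=
  if i is j.+1 then Some (X j w) else None.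

(* Conditionally on lambda'_0 = h 0, ..., lambda'_n = h n, the next value is b
   with probability [trans R p (h n) b]; multiplying by the probability of the
   history avoids conditioning on null events. *)
Definition column_chain (R : realType) (p : nat) (d : measure_display)
    (T : measurableType d) (P : probability T R) (X : nat -> {RV P >-> nat})
    : Prop :=
  forall (n : nat) (h : nat -> option nat) (b : nat),
    let H := [set w | forall i, (i <= n)%N -> state X i w = h i] in
    (P (H `&` [set w | state X n.+1 w = Some b])
     = P H * (trans R p (h n) b)%:E)%E.

Definition is_transpose (c : nat -> nat) (lam : intpart) : Prop :=
  forall j, c j = part_col lam j.+1.

Definition pi_part (R : realType) (p : nat) (lam : intpart) : R :=
  let mu := part_col lam in
  infprod_odd (fun i => 1 - 1 / p%:R ^+ i) /
  (p%:R ^+ (\sum_(1 <= i < (largest_part lam).+1) (mu i * (mu i).+1) %/ 2)%N *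
   \prod_(1 <= i < (largest_part lam).+1)
     \prod_(1 <= j < ((mu i - mu i.+1) %/ 2).+1) (1 - 1 / p%:R ^+ (2 * j))).

(* Main.v *)
Require Import Defs.
From HB Require Import structures.
From mathcomp Require Import all_boot all_order all_algebra.
From mathcomp Require Import all_classical all_reals all_analysis.
From mathcomp Require Import ring lra.

Set Implicit Arguments.
Unset Strict Implicit.
Unset Printing Implicit Defensive.

Import Order.TTheory GRing.Theory Num.Theory.
Import numFieldNormedType.Exports.

Local Open Scope classical_set_scope.
Local Open Scope ring_scope.

(* Put q = 1/p and (q)_n = (1 - q) ... (1 - q^n). That the weights K(a, .) sum
   to 1 is the coefficient of z^a in the product of the generating functions
   (-qz; q)_oo and (1 + z) / (z^2; q^2)_oo, which is 1 / (z; q)_oo. Letting a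
   tend to infinity gives Euler's sum of q^(b(b+1)/2) / (q)_b, hence the case
   a = oo. From every state the chain jumps to the absorbing state 0 with
   probability at least (q)_oo > 0, so it reaches 0 almost surely, and the
   probabilities of the finite paths from oo to 0 add up to 1. These paths are
   the transposes of the partitions, and along the transpose of lambda the
   factors (q)_a of the kernel telescope, which leaves pi(lambda). *)

(** * q-Pochhammer symbols *)

Definition qpoch {R : pzRingType} (q : R) (n : nat) : R :=
  \prod_(1 <= i < n.+1) (1 - q ^+ i).

Lemma qpoch0 {R : pzRingType} (q : R) : qpoch q 0 = 1.
Proof. by rewrite /qpoch big_geq. Qed.

Lemma qpochS {R : pzRingType} (q : R) n :
  qpoch q n.+1 = qpoch q n * (1 - q ^+ n.+1).
Proof. by rewrite /qpoch big_nat_recr. Qed.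

Definition qexp_coef {F : fieldType} (q : F) (b : nat) : F :=
  q ^+ 'C(b.+1, 2) / qpoch q b.

Lemma qexp_coef0 {F : fieldType} (q : F) : qexp_coef q 0 = 1.
Proof. by rewrite /qexp_coef qpoch0 expr0 divr1. Qed.

Definition qhalf {F : fieldType} (q : F) (n : nat) : F :=
  (qpoch (q ^+ 2) n./2)^-1.

Section finite_identity.
Context {F : fieldType}.
Variable q : F.
Hypothesis qX_neq1 : forall i, (0 < i)%N -> q ^+ i != 1.

Local Notation e := (qexp_coef q).
Local Notation h := (qhalf q).

Let onesubX_neq0 i : (0 < i)%N -> 1 - q ^+ i != 0.
Proof. by move=> i_gt0; rewrite subr_eq0 eq_sym qX_neq1. Qed.

Lemma qpoch_neq0 n : qpoch q n != 0.
Proof.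
elim: n => [|n IHn]; first by rewrite qpoch0 oner_eq0.
by rewrite qpochS mulf_neq0// onesubX_neq0.
Qed.

Lemma qexp_coefS b :
  (1 - q ^+ b.+1) * qexp_coef q b.+1 = q ^+ b.+1 * qexp_coef q b.
Proof.
rewrite /qexp_coef qpochS binS bin1 exprD.
by field; rewrite qpoch_neq0 onesubX_neq0.
Qed.

Lemma sum_qexp_coef_shift (x : nat -> F) n :
  \sum_(b < n.+1) (1 - q ^+ b) * (e b * x b) =
  \sum_(b < n) q ^+ b.+1 * (e b * x b.+1).
Proof.
rewrite big_ord_recl expr0 subrr mul0r add0r.
by apply: eq_bigr => b _; rewrite lift0 [LHS]mulrA qexp_coefS mulrA.
Qed.

Lemma qhalf_odd n : qhalf q n.*2.+1 = qhalf q n.*2.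
Proof. by rewrite /qhalf -[n.*2.+1./2]/(uphalf n.*2) uphalf_double doubleK. Qed.

Lemma qhalf_even n : (1 - q ^+ n.*2.+2) * qhalf q n.*2.+2 = qhalf q n.*2.
Proof.
have := onesubX_neq0 (ltn0Sn n.*2.+1).
rewrite -doubleS -mul2n exprM => q2n_neq0.
by rewrite /qhalf mul2n !doubleK qpochS invfM mulrCA mulfV// mulr1.
Qed.

Lemma qhalfSS n :
  (1 - q ^+ n.+2) * qhalf q n.+2 = (1 - q) * qhalf q n.+1 + q * qhalf q n.
Proof.
have [m [->|->]] : exists m, n = m.*2 \/ n = m.*2.+1.
  by exists n./2; rewrite -{1 3}(odd_double_half n); case: odd; [right|left].
- by rewrite qhalf_even qhalf_odd; ring.
- rewrite -doubleS 2!qhalf_odd -(qhalf_even m) -doubleS exprS; ring.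
Qed.

(* With G and H the generating functions of [qexp_coef q] and [qhalf q], this
   is the coefficient form of (G H)(q z) = (1 - z) (G H)(z), which follows from
   G(z) = (1 + q z) G(q z) and H(q z) = (1 + q z) (1 - z) H(z). *)
Lemma convolution_qexp_coef_qhalfS n :
  (1 - q ^+ n.+1) * \sum_(b < n.+2) e b * h (n.+1 - b) =
  \sum_(b < n.+1) e b * h (n - b).
Proof.
pose shifted := \sum_(b < n) q ^+ b.+1 * (e b * h (n - b.+1)).
have power_split : (1 - q ^+ n.+1) * \sum_(b < n.+2) e b * h (n.+1 - b) =
    \sum_(b < n.+2) (1 - q ^+ b) * (e b * h (n.+1 - b)) +
    \sum_(b < n.+1) q ^+ b * (e b * ((1 - q ^+ (n.+1 - b)) * h (n.+1 - b))).
  rewrite mulr_sumr !(big_ord_recr n.+1)/= addrAC -big_split/=; congr (_ + _).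
  apply: eq_bigr => b _; have b_le : (b <= n.+1)%N by rewrite ltnW.
  have -> : q ^+ n.+1 = q ^+ b * q ^+ (n.+1 - b) by rewrite -exprD subnKC.
  ring.
have qhalf_expand :
    \sum_(b < n.+1) q ^+ b * (e b * ((1 - q ^+ (n.+1 - b)) * h (n.+1 - b))) =
    (1 - q) * \sum_(b < n.+1) q ^+ b * (e b * h (n - b)) + shifted.
  rewrite !(big_ord_recr n)/= subSnn subnn expr1 mulrDr mulr_sumr addrAC.
  rewrite -big_split/=; congr (_ + _); last first.
    by have -> : h 1 = h 0 := qhalf_odd 0; ring.
  apply: eq_bigr => b _; have b_lt := ltn_ord b.
  by rewrite (subSn (ltnW b_lt)) -(subnSK b_lt) qhalfSS exprS; ring.
rewrite power_split qhalf_expand (sum_qexp_coef_shift (fun b => h (n.+1 - b))).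
rewrite -[shifted](sum_qexp_coef_shift (fun b => h (n - b))) mulr_sumr.
rewrite -!big_split/=; apply: eq_bigr => b _; rewrite subSS exprS; ring.
Qed.

Lemma sum_qexp_coef_qhalf n :
  \sum_(0 <= b < n.+1) qexp_coef q b * qhalf q (n - b) = (qpoch q n)^-1.
Proof.
rewrite big_mkord; elim: n => [|n IHn].
  by rewrite big_ord1 qexp_coef0 mul1r /qhalf !qpoch0.
apply: (mulfI (onesubX_neq0 (ltn0Sn n))).
rewrite convolution_qexp_coef_qhalfS IHn qpochS invfM mulrCA mulfV ?mulr1//.
exact: onesubX_neq0.
Qed.

End finite_identity.

Section odd_product.
Context {R : comPzRingType}.
Variable q : R.

Definition odd_qpoch (n : nat) : R :=
  \prod_(1 <= i < n.+1 | odd i) (1 - q ^+ i).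

Lemma odd_qpochM n : odd_qpoch n * qpoch (q ^+ 2) n./2 = qpoch q n.
Proof.
elim: n => [|n IHn]; first by rewrite /odd_qpoch !qpoch0 big_geq// mulr1.
have odd_qpochS : odd_qpoch n.+1 =
    odd_qpoch n * (if odd n.+1 then 1 - q ^+ n.+1 else 1).
  by rewrite /odd_qpoch big_mkcond big_nat_recr//= -big_mkcond.
rewrite qpochS -IHn odd_qpochS -[n.+1./2]/(uphalf n) uphalf_half /=.
have [n_odd|n_even] /= := boolP (odd n); last by rewrite add0n mulrAC.
have -> : q ^+ n.+1 = (q ^+ 2) ^+ n./2.+1.
  by rewrite -exprM -[in LHS](odd_double_half n) n_odd mul2n doubleS.
by rewrite mulr1 add1n qpochS mulrA.
Qed.

End odd_product.

Lemma cvg_half : half @ \oo --> \oo.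
Proof. by under [half]funext => n do rewrite -divn2; exact: cvg_divnr. Qed.

Lemma cvg_double : double @ \oo --> \oo.
Proof. by under [double]funext => n do rewrite -muln2; exact: cvg_mulnr. Qed.

Definition qpochoo {R : realType} (q : R) : R := limn (qpoch q).

Section infinite_product.
Context {R : realType}.
Variable q : R.
Hypothesis q_ge0 : 0 <= q.
Hypothesis q_lt1 : q < 1.

Lemma exprn_neq1 i : (0 < i)%N -> q ^+ i != 1.
Proof. by move=> i_gt0; rewrite lt_eqF// exprn_ilt1 -?lt0n. Qed.

Let onesubX_gt0 i : (0 < i)%N -> 0 < 1 - q ^+ i.
Proof. by move=> i_gt0; rewrite subr_gt0 exprn_ilt1 -?lt0n. Qed.

Lemma qpoch_gt0 n : 0 < qpoch q n.
Proof.
elim: n => [|n IHn]; first by rewrite qpoch0.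
by rewrite qpochS mulr_gt0// onesubX_gt0.
Qed.

Lemma qpoch_ge0 n : 0 <= qpoch q n.
Proof. by rewrite ltW// qpoch_gt0. Qed.

Lemma nonincreasing_qpoch : nonincreasing_seq (qpoch q).
Proof.
apply/nonincreasing_seqP => n.
by rewrite qpochS ler_piMr ?gerBl ?exprn_ge0// qpoch_ge0.
Qed.

Lemma cvg_qpoch : qpoch q @ \oo --> qpochoo q.
Proof.
apply: nonincreasing_is_cvgn; first exact: nonincreasing_qpoch.
by exists 0 => _ [n _ <-]; exact: qpoch_ge0.
Qed.

Lemma qpochoo_le n : qpochoo q <= qpoch q n.
Proof.
by apply: nonincreasing_cvgn_ge; [exact: nonincreasing_qpoch|exact: cvg_qpoch].
Qed.

(* Weierstrass' bound prod (1 - x_i) >= 1 - sum x_i for x_i = q^i, i > m,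
   multiplied by 1 - q to sum the geometric series. *)
Lemma qpoch_addn_ge m n :
  qpoch q m * (1 - q - q ^+ m.+1 + q ^+ (m + n).+1) <=
  (1 - q) * qpoch q (m + n).
Proof.
elim: n => [|n IHn]; first by rewrite addn0 subrK mulrC.
rewrite addnS qpochS mulrA; set y := q ^+ (m + n).+1.
have y_le : y <= q ^+ m.+1 by rewrite ler_wiXn2l ?ltnS ?leq_addr// ltW.
have y_ge0 : 0 <= y by rewrite exprn_ge0.
apply: le_trans (ler_wpM2r (ltW (onesubX_gt0 (ltn0Sn _))) IHn).
rewrite -mulrA ler_wpM2l ?qpoch_ge0// [q ^+ (m + n).+2]exprS -/y.
nra.
Qed.

Lemma qpochoo_gt0 : 0 < qpochoo q.
Proof.
have [m qm_lt] : exists m, q ^+ m.+1 < 1 - q.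
  have : q ^+ n @[n --> \oo] --> (0 : R) by apply: cvg_expr; rewrite ger0_norm.
  move=> /cvgr_lt/(_ (1 - q)); rewrite subr_gt0 => /(_ q_lt1)[m _ qm].
  by exists m; apply: qm => /=; exact: leqnSn.
have gap_gt0 : 0 < 1 - q - q ^+ m.+1 by rewrite subr_gt0.
suff : qpoch q m * (1 - q - q ^+ m.+1) / (1 - q) <= qpochoo q.
  by apply: lt_le_trans; rewrite !(mulr_gt0, invr_gt0) ?qpoch_gt0 ?subr_gt0.
apply: limr_ge; first exact: cvg_qpoch.
exists m => // n /= /subnKC <-.
rewrite ler_pdivrMr ?subr_gt0// mulrC [leRHS]mulrC.
apply: le_trans (qpoch_addn_ge m (n - m)).
by rewrite mulrC ler_wpM2l ?qpoch_ge0// lerDl exprn_ge0.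
Qed.

Lemma qpochoo_ge0 : 0 <= qpochoo q.
Proof. exact: ltW qpochoo_gt0. Qed.

End infinite_product.

Section euler_sum.
Context {R : realType}.
Variable q : R.
Hypothesis q_ge0 : 0 <= q.
Hypothesis q_lt1 : q < 1.

Let q2_ge0 : 0 <= q ^+ 2. Proof. exact: exprn_ge0. Qed.
Let q2_lt1 : q ^+ 2 < 1. Proof. by rewrite exprn_ilt1. Qed.

Lemma qexp_coef_ge0 b : 0 <= qexp_coef q b.
Proof. by rewrite divr_ge0 ?exprn_ge0// qpoch_ge0. Qed.

Lemma qhalf_ge1 n : 1 <= qhalf q n.
Proof.
rewrite /qhalf invf_ge1 ?qpoch_gt0// -(qpoch0 (q ^+ 2)).
by rewrite nonincreasing_qpoch.
Qed.

Lemma qhalf_ge0 n : 0 <= qhalf q n.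
Proof. exact: le_trans ler01 (qhalf_ge1 n). Qed.

Lemma nondecreasing_qhalf : nondecreasing_seq (qhalf q).
Proof.
move=> m n mn; rewrite /qhalf lef_pV2 ?posrE ?qpoch_gt0//.
by rewrite nonincreasing_qpoch// half_leq.
Qed.

Lemma cvg_qhalf : qhalf q @ \oo --> (qpochoo (q ^+ 2))^-1.
Proof.
apply: cvgV; first by rewrite gt_eqF// qpochoo_gt0.
by apply: (cvg_comp half (qpoch (q ^+ 2))); [exact: cvg_half|exact: cvg_qpoch].
Qed.

Lemma qhalf_le n : qhalf q n <= (qpochoo (q ^+ 2))^-1.
Proof. by rewrite lef_pV2 ?posrE ?qpoch_gt0 ?qpochoo_gt0 ?qpochoo_le. Qed.

Lemma cvg_odd_qpoch : odd_qpoch q @ \oo --> qpochoo q / qpochoo (q ^+ 2).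
Proof.
rewrite (_ : odd_qpoch q = qpoch q \* qhalf q).
  by apply: cvgM; [exact: cvg_qpoch|exact: cvg_qhalf].
by apply/funext => n; rewrite /= -odd_qpochM mulfK// gt_eqF// qpoch_gt0.
Qed.

Lemma sum_qexp_coef_ge n :
  qpochoo (q ^+ 2) / qpoch q n <= \sum_(0 <= b < n.+1) qexp_coef q b.
Proof.
rewrite [leLHS]mulrC -ler_pdivlMr ?qpochoo_gt0//.
rewrite -(sum_qexp_coef_qhalf (exprn_neq1 q_ge0 q_lt1)) mulr_suml.
apply: ler_sum => b _; rewrite ler_wpM2l ?qexp_coef_ge0//; exact: qhalf_le.
Qed.

Lemma sum_qexp_coef_le n :
  \sum_(0 <= b < n.+1) qexp_coef q b <= qpoch (q ^+ 2) n./2 / qpoch q n.*2.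
Proof.
rewrite -[qpoch (q ^+ 2) _]invrK -/(qhalf q n) [leRHS]mulrC.
rewrite ler_pdivlMr ?(lt_le_trans ltr01 (qhalf_ge1 n))//.
rewrite -(sum_qexp_coef_qhalf (exprn_neq1 q_ge0 q_lt1)).
rewrite -addnn mulr_suml [leRHS](big_cat_nat (n := n.+1)) ?ltnS ?leq_addr//=.
apply: ler_wpDr.
  by apply: sumr_ge0 => b _; rewrite mulr_ge0 ?qexp_coef_ge0// qhalf_ge0.
apply: ler_sum_nat => b /= b_le; rewrite ler_wpM2l ?qexp_coef_ge0//.
by apply: nondecreasing_qhalf; rewrite -addnBA// leq_addr.
Qed.

Lemma cvg_sum_qexp_coef :
  \sum_(0 <= b < n) qexp_coef q b @[n --> \oo] --> qpochoo (q ^+ 2) / qpochoo q.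
Proof.
rewrite -cvg_shiftS/=.
apply: (@squeeze_cvgr _ _ _ _ (fun n => qpochoo (q ^+ 2) / qpoch q n)
                              (fun n => qpoch (q ^+ 2) n./2 / qpoch q n.*2)).
- by apply: nearW => n; rewrite sum_qexp_coef_ge sum_qexp_coef_le.
- apply: cvgMl_tmp; apply: cvgV; last exact: cvg_qpoch.
  by rewrite gt_eqF// qpochoo_gt0.
- apply: cvgM.
    apply: (cvg_comp half (qpoch (q ^+ 2))); first exact: cvg_half.
    exact: cvg_qpoch.
  apply: cvgV; first by rewrite gt_eqF// qpochoo_gt0.
  by apply: (cvg_comp double (qpoch q)); [exact: cvg_double|exact: cvg_qpoch].
Qed.

End euler_sum.

(** * The transition kernel *)

(* [qkernel q (Some a) b] tends to [qkernel q None b] as a goes to infinity. *)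
Definition qkernel {R : realType} (q : R) (a : option nat) (b : nat) : R :=
  match a with
  | Some a => if (b <= a)%N
              then qpoch q a * (qexp_coef q b * qhalf q (a - b)) else 0
  | None => qpochoo q * (qexp_coef q b / qpochoo (q ^+ 2))
  end.

Lemma cvg_sum_eseries {R : realType} (u : R ^nat) (l : R) :
  \sum_(0 <= i < n) u i @[n --> \oo] --> l ->
  (\sum_(0 <= i <oo) (u i)%:E = l%:E)%E.
Proof.
move=> ul; apply: cvg_lim => //; under eq_fun do rewrite sumEFin.
by apply: cvg_EFin => //; exact: nearW.
Qed.

Section qkernel.
Context {R : realType}.
Variable q : R.
Hypothesis q_ge0 : 0 <= q.
Hypothesis q_lt1 : q < 1.

Let q2_ge0 : 0 <= q ^+ 2. Proof. exact: exprn_ge0. Qed.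
Let q2_lt1 : q ^+ 2 < 1. Proof. by rewrite exprn_ilt1. Qed.

Lemma qkernel_ge0 a b : 0 <= qkernel q a b.
Proof.
case: a => [a|] /=; last first.
  apply: mulr_ge0; last apply: divr_ge0.
  - exact: qpochoo_ge0.
  - exact: qexp_coef_ge0.
  - exact: qpochoo_ge0.
case: ifP => // _; apply: mulr_ge0; last apply: mulr_ge0.
- exact: qpoch_ge0.
- exact: qexp_coef_ge0.
- exact: qhalf_ge0.
Qed.

Lemma qkernel_eq0 a b : (a < b)%N -> qkernel q (Some a) b = 0.
Proof. by move=> ab; rewrite /= leqNgt ab. Qed.

Lemma qkernel0_ge a : qpochoo q <= qkernel q a 0.
Proof.
case: a => [a|] /=; rewrite qexp_coef0 mul1r.
  apply: le_trans (qpochoo_le q_ge0 q_lt1 a) _.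
  by rewrite ler_peMr ?qpoch_ge0// qhalf_ge1.
rewrite ler_peMr ?qpochoo_ge0//.
exact: le_trans (qhalf_ge1 q_ge0 q_lt1 0) (qhalf_le q_ge0 q_lt1 0).
Qed.

Lemma sum_qkernel_Some a n : (a < n)%N ->
  \sum_(0 <= b < n) qkernel q (Some a) b = 1.
Proof.
move=> an; rewrite (big_cat_nat (n := a.+1))//= [X in _ + X]big_nat_cond.
rewrite [X in _ + X]big1 ?addr0 => [|b /andP[/andP[ab _] _]]; last first.
  by rewrite leqNgt ab.
have -> : \sum_(0 <= b < a.+1) (if (b <= a)%N
      then qpoch q a * (qexp_coef q b * qhalf q (a - b)) else 0) =
    qpoch q a * \sum_(0 <= b < a.+1) qexp_coef q b * qhalf q (a - b).
  by rewrite mulr_sumr; apply: eq_big_nat => b /=; rewrite ltnS => ->.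
rewrite (sum_qexp_coef_qhalf (exprn_neq1 q_ge0 q_lt1)).
by rewrite mulfV// gt_eqF// qpoch_gt0.
Qed.

Lemma sum_qkernel a : (\sum_(0 <= b <oo) (qkernel q a b)%:E = 1)%E.
Proof.
apply: cvg_sum_eseries; case: a => [a|].
  by apply: cvg_near_cst; exists a.+1 => // n /= an; exact: sum_qkernel_Some.
rewrite /=; under eq_fun do rewrite -mulr_sumr -mulr_suml.
have <- : qpochoo q * (qpochoo (q ^+ 2) / qpochoo q / qpochoo (q ^+ 2)) = 1.
  by field; rewrite !gt_eqF ?qpochoo_gt0.
by apply: cvgMl_tmp; apply: cvgMr_tmp; exact: cvg_sum_qexp_coef.
Qed.

End qkernel.

(** * Transposes of partitions *)

Lemma eqn_ltn (m n : nat) : (forall i, (i < m)%N = (i < n)%N) -> m = n.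
Proof.
by move=> mn; apply/eqP; rewrite eqn_leq leqNgt mn ltnn leqNgt -mn ltnn.
Qed.

Lemma ltn_count_leq (s : seq nat) i j : sorted geq s -> (0 < j)%N ->
  (i < count (leq j) s)%N = (j <= nth 0%N s i)%N.
Proof.
move=> + j_gt0; elim: s i => [|x s IHs] i /=.
  by rewrite nth_nil ltn0 leqNgt j_gt0.
move=> xs; have [jx|xj] := leqP j x.
  by case: i => [|i]; rewrite ?jx//= add1n ltnS IHs ?(path_sorted xs).
have s_lt : all (gtn j) s.
  apply: sub_all (order_path_min (rev_trans leq_trans) xs) => y yx.
  exact: leq_ltn_trans xj.
have -> : count (leq j) s = 0%N.
  apply/eqP; rewrite -leqn0 leqNgt -has_count -all_predC.
  by apply: sub_all s_lt => y /=; rewrite ltnNge.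
rewrite ltn0; apply/esym/negbTE; rewrite -ltnNge; case: i => [//|i] /=.
have [i_lt|i_ge] := ltnP i (size s); first exact: (all_nthP 0%N s_lt).
by rewrite nth_default.
Qed.

Section partitions.
Implicit Types lam nu : intpart.

Lemma intpart_sorted lam : sorted geq lam.
Proof. by have /andP[] := partsP lam. Qed.

Lemma intpart_notin0 lam : 0%N \notin parts lam.
Proof. by have /andP[] := partsP lam. Qed.

Lemma nth_intpart_gt0 lam i : (0 < nth 0%N lam i)%N = (i < size lam)%N.
Proof.
have [i_lt|i_ge] := ltnP i (size lam); last by rewrite nth_default.
by rewrite lt0n; apply: contraNneq (intpart_notin0 lam) => <-; exact: mem_nth.
Qed.

Lemma eq_intpart lam nu : (forall i, nth 0%N lam i = nth 0%N nu i) -> lam = nu.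
Proof.
move=> e; apply/val_inj/(@eq_from_nth _ 0%N) => [|i _]; last exact: e.
by apply: eqn_ltn => i; rewrite -!nth_intpart_gt0 e.
Qed.

Lemma ltn_part_col lam i j : (0 < j)%N ->
  (i < part_col lam j)%N = (j <= nth 0%N lam i)%N.
Proof. by apply: ltn_count_leq; exact: intpart_sorted. Qed.

Lemma part_col_gt0 lam j : (0 < j)%N ->
  (0 < part_col lam j)%N = (j <= largest_part lam)%N.
Proof. by move=> j_gt0; rewrite ltn_part_col// nth0. Qed.

Lemma leq_part_col lam i j : (i <= j)%N -> (part_col lam j <= part_col lam i)%N.
Proof. by move=> ij; apply: sub_count => x; exact: leq_trans. Qed.

Definition transpose_seq lam : seq nat :=
  mkseq (fun i => part_col lam i.+1) (largest_part lam).

Lemma nth_transpose_seq lam j :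
  nth 0%N (transpose_seq lam) j = part_col lam j.+1.
Proof.
have [j_lt|j_ge] := ltnP j (largest_part lam); first by rewrite nth_mkseq.
rewrite nth_default ?size_mkseq//; apply/esym/eqP.
by rewrite -leqn0 leqNgt part_col_gt0// -ltnNge ltnS.
Qed.

Lemma transpose_seq_is_part lam : is_part (transpose_seq lam).
Proof.
apply/andP; split.
  apply/(sortedP 0%N) => i _; rewrite !nth_transpose_seq.
  exact: leq_part_col.
apply/mapP => -[i]; rewrite mem_iota => /andP[_ i_lt] /eqP.
by rewrite eq_sym -leqn0 leqNgt part_col_gt0// i_lt.
Qed.

Definition transpose lam : intpart := IntPart (transpose_seq_is_part lam).

Lemma nth_transpose lam j : nth 0%N (transpose lam) j = part_col lam j.+1.
Proof. exact: nth_transpose_seq. Qed.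

Lemma transposeK : involutive transpose.
Proof.
move=> lam; apply: eq_intpart => i; apply: eqn_ltn => j.
by rewrite nth_transpose ltn_part_col// nth_transpose ltn_part_col.
Qed.

Lemma is_transposeP (c : nat -> nat) lam :
  is_transpose c lam <-> forall j, c j = nth 0%N (transpose lam) j.
Proof. by split=> c_lam j; rewrite c_lam nth_transpose. Qed.

Lemma is_transpose_inj (c : nat -> nat) lam nu :
  is_transpose c lam -> is_transpose c nu -> lam = nu.
Proof.
move=> /is_transposeP c_lam /is_transposeP c_nu.
by apply/(can_inj transposeK)/eq_intpart => j; rewrite -c_lam -c_nu.
Qed.

End partitions.

(** * Paths absorbed at 0 *)

Lemma ge0_esumZl {R : realType} {T : choiceType} (I : set T)
    (f : T -> \bar R) (r : R) : 0 <= r -> (forall i, 0 <= f i)%E ->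
  \esum_(i in I) (r%:E * f i)%E = (r%:E * \esum_(i in I) f i)%E.
Proof.
move=> r_ge0 f_ge0; rewrite /esum -ereal_supZl//; last first.
  apply/set0P; exists (\sum_(x \in set0) f x), set0 => //.
  exact: fsets_set0.
congr ereal_sup; apply/seteqP; split => [_ [A fA <-]|_ [_ [A fA <-] <-]].
  by exists (\sum_(x \in A) f x); [exists A|rewrite ge0_mule_fsumr].
by exists A => //; rewrite ge0_mule_fsumr.
Qed.

(* The state 0 ends a path, which is given by the sequence [c] of its states
   after [a] and before 0. *)
Fixpoint path_weight {R : pzRingType} (k : option nat -> nat -> R)
    (a : option nat) (c : seq nat) : R :=
  if c is b :: c' then k a b * path_weight k (Some b) c' else k a 0%N.

Definition short_paths (n : nat) : set (seq nat) :=
  [set c : seq nat | 0%N \notin c /\ (size c < n)%N].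

Lemma short_paths0 : short_paths 0 = set0.
Proof. by apply/seteqP; split => // c []. Qed.

Lemma short_pathsS n : short_paths n.+1 =
  [set [::]] `|` [set x.1.+1 :: x.2 | x in setT `*`` (fun=> short_paths n)].
Proof.
apply/seteqP; split => [[|b c] [/=]|c [->//|[[b d] /= [_ [d_neq0 dn]] <-]]].
- by left.
- rewrite inE negb_or eq_sym -lt0n => /andP[b_gt0 c_neq0] cn; right.
  by exists (b.-1, c) => //=; rewrite prednK.
- by split; rewrite ?inE//= ltnS.
Qed.

Section path_weight.
Context {R : realType}.
Variable k : option nat -> nat -> R.
Hypothesis k_ge0 : forall a b, 0 <= k a b.
Hypothesis sum_k : forall a, (\sum_(0 <= b <oo) (k a b)%:E = 1)%E.

Local Notation W S a := (\esum_(c in S) (path_weight k a c)%:E)%E.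

Lemma path_weight_ge0 a c : 0 <= path_weight k a c.
Proof. by elim: c a => [|b c IHc] a //=; rewrite mulr_ge0. Qed.

Let W_ge0 S a : (0 <= W S a)%E.
Proof. by apply: esum_ge0 => c _; rewrite lee_fin path_weight_ge0. Qed.

Let kW_ge0 S a b : (0 <= (k a b)%:E * W S (Some b))%E.
Proof. by rewrite mule_ge0// lee_fin. Qed.

Lemma esum_short_pathsS n a : W (short_paths n.+1) a =
  ((k a 0)%:E +
   \sum_(0 <= b <oo) (k a b.+1)%:E * W (short_paths n) (Some b.+1))%E.
Proof.
have w_ge0 b c : (0%R <= (path_weight k b c)%:E :> \bar R)%E.
  by rewrite lee_fin path_weight_ge0.
rewrite (esumID [set [::]])// short_pathsS setUK esum_set1//; congr (_ + _)%E.
rewrite setIUl setICr set0U setIidl => [|_ [x _ <-]//].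
rewrite esum_image => [|[b c] [b' c'] _ _ [-> ->]//] /=.
under eq_esum do rewrite EFinM.
rewrite -(@esum_esum _ _ _ setT (fun=> short_paths n)
  (fun b c => (k a b.+1)%:E * (path_weight k (Some b.+1) c)%:E)%E); last first.
  by move=> b c _ _; rewrite mule_ge0// lee_fin.
rewrite nneseries_esumT//; apply: eq_esum => b _.
by rewrite ge0_esumZl.
Qed.

Lemma nneseries_kernel_recl a :
  ((k a 0)%:E + \sum_(0 <= b <oo) (k a b.+1)%:E = 1)%E.
Proof.
have kE_ge0 b : (0%R <= (k a b)%:E :> \bar R)%E by rewrite lee_fin.
rewrite -(sum_k a) [RHS]nneseries_recl//.
rewrite -(nneseries_addn 1 kE_ge0).
by under [in RHS]eq_eseriesr do rewrite addn1.
Qed.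

Lemma esum_short_paths_le1 n a : (W (short_paths n) a <= 1)%E.
Proof.
elim: n a => [|n IHn] a; first by rewrite short_paths0 esum_set0.
rewrite esum_short_pathsS -[leRHS](nneseries_kernel_recl a) leeD2l//.
apply: lee_nneseries => // b _.
by rewrite -[leRHS]mule1 lee_pmul// lee_fin.
Qed.

Lemma esum_path_weight_le1 a : (W [set c : seq nat | 0%N \notin c] a <= 1)%E.
Proof.
apply: ge_ereal_sup => _ [C [finC C_neq0] <-].
have [s Cs] := (finite_seqP C).1 finC.
pose n := (\max_(c <- s) size c).+1.
apply: le_trans (esum_short_paths_le1 n a).
apply: esum_ge; exists C => //; split => // c Cc; split; first exact: C_neq0.
by rewrite ltnS; apply: leq_bigmax_seq => //; rewrite Cs in Cc.
Qed.

Variable r : R.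
Hypothesis r_gt0 : 0 < r.
Hypothesis r_le : forall a, r <= k a 0%N.

Let kernel0_le1 a : k a 0%N <= 1.
Proof.
rewrite -lee_fin -(nneseries_kernel_recl a) leeDl//.
by apply: nneseries_ge0 => b _ _; rewrite lee_fin.
Qed.

Let r_le1 : r <= 1. Proof. exact: le_trans (r_le None) (kernel0_le1 None). Qed.

(* The chain is still away from 0 after n steps with probability at most
   (1 - r) ^ n. *)
Lemma esum_short_paths_ge n a :
  (1 <= W (short_paths n) a + ((1 - r) ^+ n)%:E)%E.
Proof.
elim: n a => [|n IHn] a; first by rewrite expr0 leeDr.
have onesubr_ge0 : 0 <= 1 - r by rewrite subr_ge0.
set t := (1 - r) ^+ n; have t_ge0 : 0 <= t by rewrite exprn_ge0.
have kernelS_le : (\sum_(0 <= b <oo) (k a b.+1)%:E <= (1 - r)%:E)%E.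
  rewrite -(@leeD2lE _ (k a 0)%:E)// nneseries_kernel_recl -EFinD lee_fin.
  by have := r_le a; lra.
rewrite esum_short_pathsS exprSr -/t -addeA EFinM.
apply: (@le_trans _ _ ((k a 0)%:E + (\sum_(0 <= b <oo)
    (k a b.+1)%:E * W (short_paths n) (Some b.+1) +
    t%:E * \sum_(0 <= b <oo) (k a b.+1)%:E))%E); last first.
  by rewrite leeD2l// leeD2l// lee_wpmul2l// lee_fin.
rewrite -nneseriesZl//; last by move=> b _; rewrite lee_fin.
rewrite -nneseriesD => [|//|b _ _]; last by rewrite mule_ge0// lee_fin.
rewrite -[leLHS](nneseries_kernel_recl a) leeD2l//.
apply: lee_nneseries => [b _ _|b _]; first by rewrite lee_fin.
rewrite [(t%:E * _)%E]muleC -ge0_muleDr ?lee_fin//.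
by rewrite -[leLHS]mule1 lee_wpmul2l ?lee_fin.
Qed.

Lemma esum_path_weight a : W [set c : seq nat | 0%N \notin c] a = 1%E.
Proof.
apply/eqP; rewrite eq_le esum_path_weight_le1/=.
apply/lee_addgt0Pr => e e_gt0.
have [n rn_le] : exists n, (1 - r) ^+ n <= e.
  have : (1 - r) ^+ n @[n --> \oo] --> (0 : R).
    by apply: cvg_expr; rewrite ger0_norm ?subr_ge0// ltrBlDr ltrDl.
  by move=> /cvgr_le/(_ e e_gt0)[n _ rn]; exists n; apply: rn => /=.
apply: le_trans (esum_short_paths_ge n a) _; rewrite leeD ?lee_fin//.
apply: ereal_sup_le => _ [C [finC C_short] <-]; exists C => //.
by split => // c /C_short[].
Qed.

Hypothesis k_eq0 : forall a b, (a < b)%N -> k (Some a) b = 0.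

Lemma kernel_00 : k (Some 0%N) 0%N = 1.
Proof.
apply: EFin_inj; rewrite -(nneseries_kernel_recl (Some 0%N)) eseries0 ?adde0//.
by move=> b _ _; rewrite k_eq0.
Qed.

Lemma path_weight_unsorted c : ~~ sorted geq c -> path_weight k None c = 0.
Proof.
case: c => [//|b c] /= bc.
suff -> : path_weight k (Some b) c = 0 by rewrite mulr0.
elim: c b bc => [//|x c IHc] b /=; rewrite negb_and => /orP[bx|/IHc->].
  by rewrite k_eq0 ?mul0r// ltnNge.
by rewrite mulr0.
Qed.

Lemma esum_path_weight_intpart :
  \esum_(lam in [set: intpart]) (path_weight k None lam)%:E = 1%E.
Proof.
rewrite -(esum_path_weight None) [RHS](esumID [set c | sorted geq c]);
  last by move=> c _; rewrite lee_fin path_weight_ge0.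
rewrite [X in (_ + X)%E]esum1 ?adde0 => [|c [_ /= /negP sc]]; last first.
  by rewrite path_weight_unsorted.
rewrite (reindex_esum setT _ parts)//; split => [lam _|lam nu _ _|c [c0 sc]].
- by split; [exact: intpart_notin0|exact: intpart_sorted].
- exact: val_inj.
- have c_part : is_part c by rewrite /is_part sc.
  by exists (IntPart c_part).
Qed.

Lemma esum_path_weight_transpose :
  \esum_(lam in [set: intpart]) (path_weight k None (transpose lam))%:E = 1%E.
Proof.
rewrite -esum_path_weight_intpart; apply/esym/reindex_esum.
split => [//|lam nu _ _ /(can_inj transposeK)//|lam _].
by exists (transpose lam); rewrite ?transposeK.
Qed.

End path_weight.

(** * The law of the transposed partition *)

Lemma measure_bigcup_countType {d} {T : sigmaRingType d} {R : realType}
    (mu : {measure set T -> \bar R}) {I : countType} (A : set I)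
    (F : I -> set T) :
  (forall i, A i -> measurable (F i)) -> trivIset A F ->
  mu (\bigcup_(i in A) F i) = \esum_(i in A) mu (F i).
Proof.
move=> mF tF; pose G n := if @unpickle I n is Some i then F i else set0.
have GE i : G (pickle i) = F i by rewrite /G pickleK.
have -> : \bigcup_(i in A) F i = \bigcup_(n in pickle @` A) G n.
  by rewrite bigcup_image; apply: eq_bigcupr => i _; rewrite GE.
rewrite measure_bigcup => [|_ [i Ai <-]|_ _ [i Ai <-] [j Aj <-]]; first last.
- by rewrite !GE => /(tF _ _ Ai Aj)->.
- by rewrite GE; exact: mF.
rewrite nneseries_esum// set_mem_set esum_image; last first.
  by move=> i j _ _ /(pcan_inj pickleK).
by apply: eq_esum => i _; rewrite GE.
Qed.

Definition history (a : option nat) (c : seq nat) (i : nat) : option nat :=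
  if i is j.+1 then Some (nth 0%N c j) else a.

Lemma prod_kernel_history {R : pzRingType} (k : option nat -> nat -> R) a c n :
  k (Some 0%N) 0%N = 1 -> (size c < n)%N ->
  \prod_(0 <= i < n) k (history a c i) (nth 0%N c i) = path_weight k a c.
Proof.
move=> k00; elim: c a n => [|b c IHc] a [//|n] c_lt; rewrite big_nat_recl//=.
  by rewrite big1 ?mulr1// => i _; rewrite !nth_nil.
by rewrite -(IHc _ n)//; congr (_ * _); apply: eq_bigr => -[].
Qed.

Section chain.
Context {R : realType} {d : measure_display} {T : measurableType d}.
Variable P : probability T R.
Variable X : nat -> {RV P >-> nat}.
Variable k : option nat -> nat -> R.
Hypothesis chainX : forall (n : nat) (h : nat -> option nat) (b : nat),
  let H := [set w | forall i, (i <= n)%N -> state X i w = h i] in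
  (P (H `&` [set w | state X n.+1 w = Some b]) = P H * (k (h n) b)%:E)%E.

Let agree (c : seq nat) (n : nat) : set T :=
  [set w | forall i, (i <= n)%N -> state X i w = history None c i].

Let agree0 c : agree c 0 = setT.
Proof. by apply/seteqP; split => // w _ [|]. Qed.

Let agreeS c n :
  agree c n.+1 = agree c n `&` (X n @^-1` [set nth 0%N c n]).
Proof.
apply/seteqP; split => [w w_c|w [w_c /= Xw] i].
  by split => [i /leqW|]; [exact: w_c|have /= [] := w_c n.+1 (leqnn _)].
by rewrite leq_eqVlt => /predU1P[->|]; [rewrite /= Xw|exact: w_c].
Qed.

Let measurable_agree c n : measurable (agree c n).
Proof.
elim: n => [|n IHn]; first by rewrite agree0.
by rewrite agreeS; apply: measurableI => //; exact: measurable_funPTI.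
Qed.

Let probability_agree c n : P (agree c n) =
  (\prod_(0 <= i < n) k (history None c i) (nth 0%N c i))%:E.
Proof.
elim: n => [|n IHn]; first by rewrite agree0 big_geq// probability_setT.
rewrite agreeS big_nat_recr//= EFinM -IHn -chainX; congr (P (_ `&` _)).
by apply/seteqP; split => [w /= ->|w /= []].
Qed.

Let path_bigcap c :
  [set w | forall j, X j w = nth 0%N c j] = \bigcap_n agree c n.
Proof.
apply/seteqP; split => [w w_c n _ [//|i] _|w w_c j]; first by rewrite /= w_c.
by have /= [] := w_c j.+1 I j.+1 (leqnn _).
Qed.

Let measurable_path c : measurable [set w | forall j, X j w = nth 0%N c j].
Proof. by rewrite path_bigcap; exact: bigcap_measurable. Qed.

Hypothesis k00 : k (Some 0%N) 0%N = 1.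

Lemma probability_path c :
  P [set w | forall j, X j w = nth 0%N c j] = (path_weight k None c)%:E.
Proof.
have mpath := measurable_path c; rewrite path_bigcap in mpath *.
have : (P \o agree c) n @[n --> \oo] --> P (\bigcap_n agree c n).
  apply: nonincreasing_cvg_mu => //.
    by rewrite (le_lt_trans (probability_le1 _ _))// ltry.
  move=> m n mn; apply/subsetPset => w w_c i im; apply: w_c.
  exact: leq_trans mn.
move/cvg_unique; apply=> //; apply: cvg_near_cst.
exists (size c).+1 => // n /= cn.
by rewrite probability_agree prod_kernel_history.
Qed.

Let transpose_event (lam : intpart) : set T :=
  [set w | is_transpose (fun j => X j w) lam].

Let transpose_eventE lam :
  transpose_event lam = [set w | forall j, X j w = nth 0%N (transpose lam) j].
Proof. by apply/seteqP; split => w /is_transposeP. Qed.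

Let measurable_transpose_event lam : measurable (transpose_event lam).
Proof. by rewrite transpose_eventE; exact: measurable_path. Qed.

Lemma probability_is_transpose_in (A : set intpart) :
  P [set w | exists2 lam, A lam & is_transpose (fun j => X j w) lam] =
  \esum_(lam in A) (path_weight k None (transpose lam))%:E.
Proof.
rewrite -[X in P X]/(\bigcup_(lam in A) transpose_event lam).
rewrite measure_bigcup_countType//.
  by apply: eq_esum => lam _; rewrite transpose_eventE; exact: probability_path.
by move=> lam nu _ _ [w [w_lam w_nu]]; exact: is_transpose_inj w_lam w_nu.
Qed.

Lemma ae_is_transpose :
  \esum_(lam in [set: intpart]) (path_weight k None (transpose lam))%:E = 1%E ->
  {ae P, forall w, (forall j, (X j.+1 w <= X j w)%N) /\
                   exists lam : intpart, is_transpose (fun j => X j w) lam}.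
Proof.
move=> mass1.
pose E := [set w | exists2 lam, setT lam & is_transpose (fun j => X j w) lam].
have mE : measurable E.
  exact: (@countable_bigcupT_measurable _ _ _ transpose_event).
exists (~` E); split; first exact: measurableC.
  by rewrite probability_setC// probability_is_transpose_in mass1 subee.
apply: subsetC => w [lam _ w_lam]; split; last by exists lam.
by move=> j; rewrite !w_lam leq_part_col.
Qed.

End chain.

(** * Telescoping of the kernel along a partition *)

Definition path_factor {F : fieldType} (q : F) (c : seq nat) : F :=
  \prod_(0 <= i < size c)
    (q ^+ 'C((nth 0%N c i).+1, 2) * qhalf q (nth 0%N c i - nth 0%N c i.+1)).

Lemma path_factor_nil {F : fieldType} (q : F) : path_factor q [::] = 1.
Proof. by rewrite /path_factor big_geq. Qed.

Lemma path_factor_cons {F : fieldType} (q : F) b c : path_factor q (b :: c) =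
  q ^+ 'C(b.+1, 2) * qhalf q (b - nth 0%N c 0) * path_factor q c.
Proof. by rewrite /path_factor big_nat_recl. Qed.

Section path_weight_qkernel.
Context {R : realType}.
Variable q : R.
Hypothesis q_ge0 : 0 <= q.
Hypothesis q_lt1 : q < 1.

Let qexp_coefM b : qexp_coef q b * qpoch q b = q ^+ 'C(b.+1, 2).
Proof. by rewrite mulfVK// gt_eqF// qpoch_gt0. Qed.

(* The factors [qpoch q] of consecutive steps cancel. *)
Lemma path_weight_qkernel_Some a c : sorted geq (a :: c) ->
  path_weight (qkernel q) (Some a) c =
  qpoch q a * qhalf q (a - nth 0%N c 0) * path_factor q c.
Proof.
elim: c a => [|b c IHc] a /=.
  by rewrite qexp_coef0 mul1r path_factor_nil mulr1.
by move=> /andP[ba bc]; rewrite ba IHc// path_factor_cons -qexp_coefM; ring.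
Qed.

Lemma path_weight_qkernel_None c : sorted geq c ->
  path_weight (qkernel q) None c =
  qpochoo q / qpochoo (q ^+ 2) * path_factor q c.
Proof.
case: c => [_|b c bc] /=.
  by rewrite qexp_coef0 mul1r path_factor_nil mulr1.
by rewrite path_weight_qkernel_Some// path_factor_cons -qexp_coefM; ring.
Qed.

End path_weight_qkernel.

Section kernel_K.
Context {R : realType}.
Variable p : nat.

Local Notation q := (p%:R^-1 : R).

Lemma prod_qpoch n : \prod_(1 <= i < n.+1) (1 - 1 / p%:R ^+ i) = qpoch q n.
Proof. by apply: eq_bigr => i _; rewrite div1r exprVn. Qed.

Lemma prod_qpoch_sqr n :
  \prod_(1 <= i < n.+1) (1 - 1 / p%:R ^+ (2 * i)) = qpoch (q ^+ 2) n.
Proof. by apply: eq_bigr => i _; rewrite div1r -exprVn exprM. Qed.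

Lemma infprod_qpoch : infprod (fun i => 1 - 1 / p%:R ^+ i) = qpochoo q.
Proof. by rewrite /infprod; under eq_fun do rewrite prod_qpoch. Qed.

Lemma infprod_qpoch_sqr :
  infprod (fun i => 1 - 1 / p%:R ^+ (2 * i)) = qpochoo (q ^+ 2).
Proof. by rewrite /infprod; under eq_fun do rewrite prod_qpoch_sqr. Qed.

Lemma transE : trans R p = qkernel q.
Proof.
apply/funext => a; apply/funext => b; rewrite /trans; case: a => [a|] /=.
  case: ifP => // _; rewrite !prod_qpoch prod_qpoch_sqr divn2.
  by rewrite !invfM -!exprVn !mulrA.
by rewrite infprod_qpoch infprod_qpoch_sqr prod_qpoch !invfM -!exprVn !mulrA.
Qed.

Hypothesis p_gt1 : (1 < p)%N.

Let q_ge0 : 0 <= q. Proof. by rewrite invr_ge0. Qed.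
Let q_lt1 : q < 1. Proof. by rewrite invf_lt1 ?ltr1n// ltr0n ltnW. Qed.

Lemma trans_ge0 a b : 0 <= trans R p a b.
Proof. by rewrite transE qkernel_ge0. Qed.

Lemma sum_trans a : (\sum_(0 <= b <oo) (trans R p a b)%:E = 1)%E.
Proof. by rewrite transE sum_qkernel. Qed.

Lemma trans_eq0 a b : (a < b)%N -> trans R p (Some a) b = 0.
Proof. by rewrite transE; exact: qkernel_eq0. Qed.

Lemma trans_00 : trans R p (Some 0%N) 0%N = 1.
Proof. exact: kernel_00 trans_ge0 sum_trans trans_eq0. Qed.

Lemma infprod_odd_qpoch : infprod_odd (fun i => 1 - 1 / p%:R ^+ i) =
  qpochoo q / qpochoo (q ^+ 2).
Proof.
rewrite -(cvg_lim (@Rhausdorff R) (cvg_odd_qpoch q_ge0 q_lt1)).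
rewrite /infprod_odd; congr (limn _); apply/funext => n.
by apply: eq_bigr => i _; rewrite div1r exprVn.
Qed.

Lemma pi_partE (lam : intpart) :
  pi_part R p lam = path_weight (trans R p) None (transpose lam).
Proof.
rewrite transE path_weight_qkernel_None ?intpart_sorted//.
rewrite /pi_part infprod_odd_qpoch; congr (_ * _).
rewrite /path_factor size_mkseq big_split/= invfM !big_add1/=; congr (_ * _).
  rewrite -exprVn -expr_sum; congr (_ ^+ _); apply: eq_bigr => i _.
  by rewrite nth_transpose bin2 /= divn2 mulnC.
rewrite -prodfV; apply: eq_bigr => i _.
by rewrite prod_qpoch_sqr !nth_transpose divn2.
Qed.

Lemma pi_part_ge0 (lam : intpart) : 0 <= pi_part R p lam.
Proof. by rewrite pi_partE path_weight_ge0//; exact: trans_ge0. Qed.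

Lemma esum_path_weight_trans : \esum_(lam in [set: intpart])
  (path_weight (trans R p) None (transpose lam))%:E = 1%E.
Proof.
apply: (esum_path_weight_transpose trans_ge0 sum_trans (r := qpochoo q)).
- exact: qpochoo_gt0.
- by move=> a; rewrite transE qkernel0_ge.
- exact: trans_eq0.
Qed.

Lemma esum_pi_part (A : set intpart) : \esum_(lam in A) (pi_part R p lam)%:E =
  \esum_(lam in A) (path_weight (trans R p) None (transpose lam))%:E.
Proof. by apply: eq_esum => lam _; rewrite pi_partE. Qed.

End kernel_K.

Theorem theorem3p1 (R : realType) (p : nat) (p_prime : prime p) :
  (* each K(a, .) is a probability distribution on the b <= a *)
  (forall a : option nat,
     (forall b : nat, 0 <= trans R p a b) /\
     (\sum_(0 <= b <oo) (trans R p a b)%:E = 1)%E) /\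
  (* pi is a probability measure on partitions *)
  ((forall lam : intpart, 0 <= pi_part R p lam) /\
   \esum_(lam in [set: intpart]) (pi_part R p lam)%:E = 1%E) /\
  (forall (d : measure_display) (T : measurableType d) (P : probability T R)
     (X : nat -> {RV P >-> nat}),
     column_chain p X ->
     {ae P, forall w, (forall j, (X j.+1 w <= X j w)%N) /\
                      exists lam : intpart, is_transpose (fun j => X j w) lam}
     /\
     (forall A : set intpart,
        P [set w | exists2 lam, A lam & is_transpose (fun j => X j w) lam]
        = \esum_(lam in A) (pi_part R p lam)%:E)).
Proof.
have p_gt1 := prime_gt1 p_prime.
split=> [a|]; first by split=> [b|]; [exact: trans_ge0|exact: sum_trans].
split=> [|d T P X chainX].
  split=> [lam|]; first exact: pi_part_ge0.
  by rewrite esum_pi_part//; exact: esum_path_weight_trans.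
have k00 := @trans_00 R p p_gt1; split=> [|A].
  exact: ae_is_transpose chainX k00 (esum_path_weight_trans p_gt1).
rewrite esum_pi_part//; exact: probability_is_transpose_in chainX k00 A.
Qed.
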